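(* Let $X$ be a topological space. If the Alexandroff duplicate $A(X)$ is star-K-Menger (respectively, star-K-Hurewicz), then $X$ is also star-K-Menger (respectively, star-K-Hurewicz).
   Context: The Alexandroff duplicate of $X$ is $A(X)=X\times\{0,1\}$, where each point of $X\times\{1\}$ is isolated and a basic neighbourhood of $\langle x,0\rangle$ is a set of the form $(U\times\{0\})\cup((U\times\{1\})\setminus\{\langle x,1\rangle\})$ with $U$ a neighbourhood of $x$ in $X$. For a subset $A$ of a space $Z$ and a collection $\mathcal{P}$ of subsets of $Z$, $St(A,\mathcal{P})=\bigcup\{B\in\mathcal{P} : A\cap B\neq\emptyset\}$. A space $Z$ is: - star-K-Menger if for each sequence $(\mathcal{U}_n)_{n\in\mathbb{N}}$ of open covers of $Z$ there are compact sets $K_n\subseteq Z$ such that $\{St(K_n,\mathcal{U}_n) : n\in\mathbb{N}\}$ covers $Z$; - star-K-Hurewicz if for each sequence $(\mathcal{U}_n)_{n\in\mathbb{N}}$ of open covers of $Z$ there are compact sets $K_n\subseteq Z$ such that each $z\in Z$ belongs to $St(K_n,\mathcal{U}_n)$ for all but finitely many $n$. *)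

(* Defs.v *)
From HB Require Import structures.
From mathcomp Require Import all_boot all_order all_algebra.
From mathcomp Require Import all_classical.
From mathcomp Require Import topology.

Set Implicit Arguments.
Unset Strict Implicit.
Unset Printing Implicit Defensive.

Local Open Scope classical_set_scope.

(* An alias of X * bool, so that it does not inherit the product topology.
   The levels 0 and 1 are false and true. *)
Definition alexandroff_duplicate (X : Type) : Type := (X * bool)%type.

HB.instance Definition _ (X : choiceType) :=
  Choice.copy (alexandroff_duplicate X) (X * bool)%type.

Section AlexandroffDuplicate.
Context {X : topologicalType}.
Local Notation AX := (alexandroff_duplicate X).

Definition duplicate_basic (x : X) (U : set X) : set AX :=
  (U `*` [set false]) `|` ((U `*` [set true]) `\ ((x, true) : AX)).

(* The topology determined by the basic neighbourhoods: a set is open when it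
   contains a basic neighbourhood of each of its points.  The points (x, true)
   impose no condition, their basic neighbourhood being the singleton.
   This is a topology for every X, and it is the only one in which the points
   (x, true) can be isolated while the sets [duplicate_basic x U] form a
   neighbourhood base at every (x, false).  They do form one when X is T1 (lemma [nbhs_duplicate0]); without separation they
   may fail to satisfy the neighbourhood axioms (e.g. X indiscrete with two
   points), and no topology then has them as a neighbourhood base. *)
Definition duplicate_open : set_system AX :=
  [set A | forall x, A (x, false) ->
    exists2 U, nbhs x U & duplicate_basic x U `<=` A].

Lemma duplicate_openT : duplicate_open setT.
Proof. by move=> x _; exists setT => //; exact: filterT. Qed.

Lemma duplicate_basicS x U V : U `<=` V ->
  duplicate_basic x U `<=` duplicate_basic x V.
Proof.
by move=> UV [y b] [[/= /UV Vy bF]|[[/= /UV Vy bT] yx]]; [left|right].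
Qed.

Lemma duplicate_openI : setI_closed duplicate_open.
Proof.
move=> A B oA oB x [/oA[U xU UA] /oB[V xV VB]]; exists (U `&` V).
  exact: filterI.
move=> p pUV; split.
- by apply/UA/(duplicate_basicS _ pUV) => ? [].
- by apply/VB/(duplicate_basicS _ pUV) => ? [].
Qed.

Lemma duplicate_open_bigcup (I : Type) (f : I -> set AX) :
  (forall i, duplicate_open (f i)) -> duplicate_open (\bigcup_i f i).
Proof.
move=> fo x [i _ /fo[U xU Uf]]; exists U => // p /Uf fp.
by exists i.
Qed.

HB.instance Definition _ := isOpenTopological.Build AX
  duplicate_openT duplicate_openI duplicate_open_bigcup.

Lemma duplicate_openP (A : set AX) : open A <-> duplicate_open A.
Proof. by []. Qed.

Lemma open_duplicate1 (x : X) : open ([set (x, true)] : set AX).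
Proof. by apply/duplicate_openP => y /= []. Qed.

Lemma nbhs_duplicate0 (x : X) : accessible_space X ->
  nbhs ((x, false) : AX) = filter_from (nbhs x) (duplicate_basic x).
Proof.
move=> T1; rewrite (@nbhsE AX); apply/seteqP; split => A /=.
  move=> [B [/duplicate_openP oB Bx] BA].
  by have [U xU UB] := oB x Bx; exists U => // p /UB/BA.
move=> [U]; rewrite nbhsE => -[V [oV Vx] VU] UA.
exists (duplicate_basic x V); last by move=> p /(duplicate_basicS VU)/UA.
split; last by left.
apply/duplicate_openP => y [[/= Vy _]|[[]]//].
have [->|yx] := eqVneq y x.
  by exists V => //; exact: open_nbhs_nbhs.
have [W [oW]] := T1 y x yx; rewrite !inE/= => Wy Wx.
exists (V `&` W); first by apply: open_nbhs_nbhs; split => //; exact: openI.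
move=> [z b] [[/= [Vz Wz] bF]|[[/= [Vz Wz] bT] _]]; first by left.
by right; split => // -[zx _]; apply: Wx; rewrite -zx.
Qed.

End AlexandroffDuplicate.

Definition open_cover {Z : topologicalType} (P : set (set Z)) : Prop :=
  P `<=` open /\ \bigcup_(B in P) B = setT.

Definition St {Z : Type} (A : set Z) (P : set (set Z)) : set Z :=
  \bigcup_(B in [set B | P B /\ A `&` B !=set0]) B.

Definition star_K_Menger (Z : topologicalType) : Prop :=
  forall U : nat -> set (set Z), (forall n, open_cover (U n)) ->
  exists2 K : nat -> set Z, (forall n, compact (K n)) &
    \bigcup_n St (K n) (U n) = setT.

Definition star_K_Hurewicz (Z : topologicalType) : Prop :=
  forall U : nat -> set (set Z), (forall n, open_cover (U n)) ->
  exists2 K : nat -> set Z, (forall n, compact (K n)) &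
    forall z, finite_set [set n | ~ St (K n) (U n) z].

(* Main.v *)
(** The projection of the duplicate onto [X] is a continuous surjection, and
    both properties pass to continuous images: pull the covers back, push the
    compact sets forward. *)
Require Import Defs.
From mathcomp Require Import all_boot all_classical topology.

Local Open Scope classical_set_scope.

(** Both transfers rest on the identity St(K, f^{-1}P) = f^{-1}(St(f(K), P)) of [St_preimage]. If
    compact sets K_n serve the pulled-back covers of the domain, then the compact images f(K_n)
    serve the original covers index by index, and surjectivity of f reaches every point of the
    codomain. The theorem is the case f = [fst]. *)

Lemma continuous_duplicate_fst (X : topologicalType) :
  continuous (fst : alexandroff_duplicate X -> X).
Proof.
apply/continuousP => U oU; apply/duplicate_openP => x Ux.
(* Only points at level 0 need checking, and both levels of [duplicate_basic x U] project into
   [U]. *)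
exists U; first exact: open_nbhs_nbhs.
by move=> [y b] [[/= Uy _]|[[/= Uy _] _]].
Qed.

Lemma open_cover_preimage (Y Z : topologicalType) (f : Y -> Z)
    (P : set (set Z)) :
  continuous f -> open_cover P -> open_cover (preimage f @` P).
Proof.
move=> /continuousP cf [oP PT]; split=> [_ [B /oP oB <-]|]; first exact: cf.
rewrite -subTset => y _.
have [B PB Bfy] : (\bigcup_(B in P) B) (f y) by rewrite PT.
by exists (f @^-1` B) => //; exists B.
Qed.

(** The preimage of B meets K exactly when B meets f(K). *)
Lemma St_preimage (Y Z : Type) (f : Y -> Z) (K : set Y) (P : set (set Z)) :
  St K (preimage f @` P) = f @^-1` St (f @` K) P.
Proof.
apply/seteqP; split=> y.
  move=> [_ [[B PB <-] [k [Kk Bfk]]] Bfy].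
  by exists B => //; split=> //; exists (f k); split=> //; exists k.
move=> [B [PB [_ [[k Kk <-] Bfk]]] Bfy].
by exists (f @^-1` B) => //; split; [exists B|exists k].
Qed.

Lemma continuous_image_compact (Y Z : topologicalType) (f : Y -> Z)
    (K : set Y) :
  continuous f -> compact K -> compact (f @` K).
Proof. by move=> cf; apply/continuous_compact/continuous_subspaceT. Qed.

Lemma star_K_Menger_image (Y Z : topologicalType) (f : Y -> Z) :
  continuous f -> set_surj setT setT f -> star_K_Menger Y -> star_K_Menger Z.
Proof.
move=> cf sf MY U oU.
have [K cK KT] := MY _ (fun n => open_cover_preimage _ _ f _ cf (oU n)).
exists (fun n => f @` K n); first by move=> n; exact: continuous_image_compact.
rewrite -subTset => z /sf[y _ <-].
have [n _] : (\bigcup_n St (K n) (preimage f @` U n)) y by rewrite KT.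
by rewrite St_preimage; exists n.
Qed.

Lemma star_K_Hurewicz_image (Y Z : topologicalType) (f : Y -> Z) :
  continuous f -> set_surj setT setT f ->
  star_K_Hurewicz Y -> star_K_Hurewicz Z.
Proof.
move=> cf sf HY U oU.
have [K cK KT] := HY _ (fun n => open_cover_preimage _ _ f _ cf (oU n)).
exists (fun n => f @` K n); first by move=> n; exact: continuous_image_compact.
move=> z; have [y _ <-] := sf z I.
(* The indices at which [f y] is missed are exactly those at which [y] is missed. *)
by apply: sub_finite_set (KT y) => n /=; rewrite St_preimage.
Qed.

Theorem theorem3p23 (X : topologicalType) :
  (star_K_Menger (alexandroff_duplicate X) -> star_K_Menger X) /\
  (star_K_Hurewicz (alexandroff_duplicate X) -> star_K_Hurewicz X).
Proof.
have sfst : set_surj setT setT (fst : alexandroff_duplicate X -> X).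
  by move=> x _; exists (x, false).
by split; [apply: star_K_Menger_image sfst|apply: star_K_Hurewicz_image sfst];
  exact: continuous_duplicate_fst.
Qed.
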